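(* Let $A$ be an $n\times n$ (real symmetric) positive definite matrix, let $b\in\mathbb{R}^n$, and let $S\in\mathbb{R}^{n\times p}$ be a random matrix such that $\mu = \lambda_{\min}(\mathbb{E}[P_{A^{1/2}S}]) > 0$. Let $x_*$ denote the solution to $Ax=b$. Let $S_0,S_1,\dots$ be independent copies of $S$. There exists a starting point $x_0\in\mathbb{R}^n$ such that the sequence defined by $$x_{k+1} = x_k - S_k(S_k^{T}AS_k)^{\dagger}S_k^{T}(Ax_k-b),\qquad k\ge 0,$$ satisfies, for all $k\geq 0$, $$\mathbb{E}[\|x_k-x_*\|_A] \geq (1-\mu)^k\|x_0-x_*\|_A.$$
   Context: For a matrix $M$, $M^{\dagger}$ is the Moore-Penrose pseudo-inverse and $P_M$ is the orthogonal projector onto the range of $M$; for positive semi-definite $M$, $M^{1/2}$ is its positive semi-definite square root; $\lambda_{\min}$ denotes the smallest eigenvalue. For positive definite $M$, $\|x\|_M = \sqrt{x^{T}Mx}$. The recursion is the (non-accelerated) randomized block Gauss-Seidel update, and the expectation of $\|x_k-x_*\|_A$ is over the randomness of $S_0,S_1,\dots$. *)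

(* Defs.v *)
From HB Require Import structures.
From mathcomp Require Import all_boot all_order all_algebra finmap.
From mathcomp Require Import all_classical all_reals all_analysis.

Set Implicit Arguments.
Unset Strict Implicit.
Unset Printing Implicit Defensive.

Import Order.TTheory GRing.Theory Num.Theory.
Import numFieldNormedType.Exports.

Local Open Scope classical_set_scope.
Local Open Scope ring_scope.

Section MatrixNotions.
Variable R : realType.

Definition quad_form n (M : 'M[R]_n) (x : 'cV[R]_n) : R :=
  (x^T *m M *m x) 0 0.

Definition posdef n (M : 'M[R]_n) : Prop :=
  M^T = M /\ forall x : 'cV[R]_n, x != 0 -> 0 < quad_form M x.

Definition possemidef n (M : 'M[R]_n) : Prop :=
  M^T = M /\ forall x : 'cV[R]_n, 0 <= quad_form M x.

Definition mxnorm n (M : 'M[R]_n) (x : 'cV[R]_n) : R :=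
  Num.sqrt (quad_form M x).

(* The three matrices below are each characterized uniquely by the set they are
   picked from; the default value 0 is only reached when that set is empty,
   which never happens for [pinv] and [range_proj], nor for [psd_sqrt] at a
   positive semi-definite matrix. *)

Definition psd_sqrt n (M : 'M[R]_n) : 'M[R]_n :=
  xget 0 [set X | possemidef X /\ X *m X = M].

(* Penrose's four conditions. *)
Definition is_pinv m n (M : 'M[R]_(m, n)) (X : 'M[R]_(n, m)) : Prop :=
  [/\ M *m X *m M = M, X *m M *m X = X,
      (M *m X)^T = M *m X & (X *m M)^T = X *m M].

(* Not to be confused with [pinvmx], which is only a one-sided inverse. *)
Definition pinv m n (M : 'M[R]_(m, n)) : 'M[R]_(n, m) :=
  xget 0 [set X | is_pinv M X].

(* The transposes turn the row spaces of [%MS] into column spaces. *)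
Definition is_range_proj m n (M : 'M[R]_(m, n)) (Q : 'M[R]_m) : Prop :=
  [/\ Q *m Q = Q, Q^T = Q & (Q^T == M^T)%MS].

Definition range_proj m n (M : 'M[R]_(m, n)) : 'M[R]_m :=
  xget 0 [set Q | is_range_proj M Q].

Definition is_lambda_min n (M : 'M[R]_n) (mu : R) : Prop :=
  eigenvalue M mu /\ forall a : R, eigenvalue M a -> mu <= a.

End MatrixNotions.

(* Real matrices with their Borel sigma-algebra. *)
Definition borel_mx (R : realType) (n p : nat) :=
  g_sigma_algebraType (@open 'M[R]_(n, p)).

Section RandomMatrices.
Context d (T : measurableType d) (R : realType) (P : probability T R).

Definition expectation_mx m n (X : T -> 'M[R]_(m, n)) : 'M[R]_(m, n) :=
  \matrix_(i, j) fine ('E_P[fun w => X w i j])%E.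

Context d' (T' : measurableType d').

(* Only measurable events are compared: a probability is unconstrained outside
   the sigma-algebra. *)
Definition same_distribution (X Y : {RV P >-> T'}) : Prop :=
  forall B : set T', measurable B -> distribution P X B = distribution P Y B.

Definition mutually_independent (X : nat -> {RV P >-> T'}) : Prop :=
  forall (J : {fset nat}) (B : nat -> set T'),
    (forall i, measurable (B i)) ->
    P (\bigcap_(i in [set` J]) (X i @^-1` B i)) =
    (\prod_(i <- J) P (X i @^-1` B i))%E.

End RandomMatrices.

Fixpoint gauss_seidel (R : realType) (n p : nat) (A : 'M[R]_n) (b : 'cV[R]_n)
    (s : nat -> 'M[R]_(n, p)) (x0 : 'cV[R]_n) (k : nat) : 'cV[R]_n :=
  if k is k'.+1 then
    let x := gauss_seidel A b s x0 k' in
    x - s k' *m pinv ((s k')^T *m A *m s k') *m (s k')^T *m (A *m x - b)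
  else x0.

(* Main.v *)
Require Import Defs.
From HB Require Import structures.
From mathcomp Require Import all_boot all_order all_algebra finmap.
From mathcomp Require Import all_classical all_reals all_analysis.
From mathcomp Require Import measurable_realfun ring lra.

(** Let [B] be the symmetric square root of [A] and [e k = B (x k - xstar)], so that
    the Euclidean norm of [e k] is the [A]-norm of the error.  One step of the
    method multiplies [e k] by [I - Q(S k)], where [Q(S)] is the orthogonal
    projector onto the range of [B S] ([range_proj_pinv],
    [gauss_seidel_error]).  Let [u] be a row vector with [u E[Q(S)] = mu u] and
    start from [e 0 = u^T].  By independence the mean of
    [u (I - Q(S (k-1))) ... (I - Q(S 0)) u^T] factors, and each factor contributes
    [1 - mu], so [E[u e k] = (1 - mu)^k |u|^2] ([mean_product]).  Since
    [u e k <= |u| |e k|], dividing by [|u|] gives the bound.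

    Two points need work.  Expectations must be those of measurable functions, so
    [Q(S)] has to depend measurably on [S] although it is defined by a choice.
    This is read off the Gram-Schmidt formula for the projector, which, with the
    convention [0^-1 = 0], is a composition of additions, multiplications and
    inverses of entries ([range_projE], [measurable_range_proj]).

    Independence is given for finite families of events and is needed for bounded
    functions.  A bounded function [h] of the past is handled through the
    property that it is uncorrelated with all events of the future
    ([indep_future]).  Multiplying [h] by a bounded function of the present
    preserves this property, one step later, and multiplies the means
    ([indep_future_step]); the extension from indicators to bounded functions is
    a halving argument ([bounded_linear_vanish]). *)

Set Implicit Arguments.
Unset Strict Implicit.
Unset Printing Implicit Defensive.

Import Order.TTheory GRing.Theory Num.Theory.
Import numFieldNormedType.Exports.

Local Open Scope classical_set_scope.
Local Open Scope ring_scope.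

(** * Orthogonal projectors and pseudo-inverses *)

Section RangeProjection.
Variable R : realType.

Lemma col_sqnorm n (x : 'cV[R]_n) : (x^T *m x) 0 0 = \sum_i x i 0 ^+ 2.
Proof. by rewrite mxE; apply: eq_bigr => i _; rewrite mxE expr2. Qed.

Lemma col_sqnorm_eq0 n (x : 'cV[R]_n) : ((x^T *m x) 0 0 == 0) = (x == 0).
Proof.
apply/eqP/eqP => [|->]; last by rewrite mulmx0 mxE.
rewrite col_sqnorm => /psumr_eq0P h; apply/colP => i; rewrite mxE.
by apply/eqP; rewrite -sqrf_eq0 h// => j _; exact: sqr_ge0.
Qed.

Lemma mulmx_trmx_eq0 m n (M : 'M[R]_(m, n)) : M^T *m M = 0 -> M = 0.
Proof.
move=> h; apply/matrixP => i j; rewrite [RHS]mxE.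
have /eqP : ((col j M)^T *m col j M) 0 0 = 0.
  have /matrixP/(_ j j) := h; rewrite !mxE => {2}<-.
  by apply: eq_bigr => k _; rewrite !mxE.
by rewrite col_sqnorm_eq0 => /eqP/colP/(_ i); rewrite !mxE.
Qed.

(** Enlarges the range of the orthogonal projector [Q] by the vector [c]: the
    residual [r] of [c] is orthogonal to the range of [Q], so the projector onto
    the line it spans can be added.  When [r = 0] the inverse is [0^-1 = 0] and
    [Q] is left unchanged, as it should be; no case distinction is made, so the
    entries of the result are expressions in [+], [*] and the total inverse,
    which is what makes the projector measurable below. *)
Definition gram_schmidt_step n (c : 'cV[R]_n) (Q : 'M[R]_n) : 'M[R]_n :=
  let r := c - Q *m c in Q + ((r^T *m r) 0 0)^-1 *: (r *m r^T).

Definition gram_schmidt n (cs : seq 'cV[R]_n) : 'M[R]_n :=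
  foldr (@gram_schmidt_step n) 0 cs.

(** All four facts come from [Q r = 0] and its transpose [r^T Q = 0]. *)
Lemma gram_schmidt_stepP n (c : 'cV[R]_n) (Q : 'M[R]_n) :
  Q *m Q = Q -> Q^T = Q ->
  [/\ gram_schmidt_step c Q *m gram_schmidt_step c Q = gram_schmidt_step c Q,
      (gram_schmidt_step c Q)^T = gram_schmidt_step c Q,
      gram_schmidt_step c Q *m c = c &
      forall x : 'cV[R]_n, Q *m x = x -> gram_schmidt_step c Q *m x = x].
Proof.
move=> QQ Qt; rewrite /gram_schmidt_step; set r := c - Q *m c.
have Qr : Q *m r = 0 by rewrite mulmxBr mulmxA QQ subrr.
have rQ : r^T *m Q = 0 by rewrite -[Q in LHS]Qt -trmx_mul Qr trmx0.
have rr : r^T *m r = ((r^T *m r) 0 0)%:M by exact: mx11_scalar.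
set a := (r^T *m r) 0 0 in rr *.
have fixQ (x : 'cV[R]_n) : Q *m x = x -> (Q + a^-1 *: (r *m r^T)) *m x = x.
  move=> Qx; rewrite mulmxDl Qx -scalemxAl -mulmxA.
  by rewrite -[X in r^T *m X]Qx [r^T *m _]mulmxA rQ mul0mx mulmx0 scaler0 addr0.
split=> //.
- rewrite mulmxDl !mulmxDr QQ -!scalemxAl -!scalemxAr mulmxA Qr mul0mx.
  rewrite scaler0 addr0 -[r *m r^T *m Q]mulmxA rQ mulmx0 scaler0 add0r.
  congr (_ + _).
  rewrite mulmxA -[r *m r^T *m r]mulmxA rr mul_mx_scalar -scalemxAl !scalerA.
  have [->|a0] := eqVneq a 0; first by rewrite invr0 !mul0r.
  by congr (_ *: _); field.
- by rewrite linearD/= linearZ/= trmx_mul trmxK Qt.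
- have cE : c = Q *m c + r by rewrite addrC subrK.
  rewrite [in LHS]cE mulmxDr fixQ ?mulmxA ?QQ// [RHS]cE; congr (_ + _).
  rewrite mulmxDl Qr add0r -scalemxAl -mulmxA rr mul_mx_scalar scalerA.
  have [a0|a0] := eqVneq a 0; last by rewrite mulVf// scale1r.
  have /eqP -> : r == 0 by rewrite -col_sqnorm_eq0; apply/eqP.
  by rewrite scaler0.
Qed.

Lemma gram_schmidtP n (cs : seq 'cV[R]_n) :
  [/\ gram_schmidt cs *m gram_schmidt cs = gram_schmidt cs,
      (gram_schmidt cs)^T = gram_schmidt cs &
      forall c, c \in cs -> gram_schmidt cs *m c = c].
Proof.
elim: cs => [|c cs [QQ Qt Qc]] /=; first by rewrite mul0mx trmx0; split.
have [? ? Pc PQ] := gram_schmidt_stepP c QQ Qt; split=> // x.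
by rewrite inE => /predU1P[->//|/Qc/PQ].
Qed.

Lemma gram_schmidt_sub m n (M : 'M[R]_(m, n)) (cs : seq 'cV[R]_n) :
  (forall c, c \in cs -> (c^T <= M)%MS) -> (gram_schmidt cs <= M)%MS.
Proof.
elim: cs => [_|c cs IH h] /=; first exact: sub0mx.
have [_ Qt _] := gram_schmidtP cs.
have QM : (gram_schmidt cs <= M)%MS.
  by apply: IH => x xcs; rewrite h// inE xcs orbT.
rewrite addmx_sub// scalemx_sub// mulmx_sub// linearB/= trmx_mul Qt.
by rewrite addmx_sub ?h ?mem_head// -scaleN1r scalemx_sub// mulmx_sub.
Qed.

Lemma gram_schmidt_range n p (M : 'M[R]_(n, p)) :
  is_range_proj M (gram_schmidt [seq col j M | j <- enum 'I_p]).
Proof.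
have [QQ Qt Qc] := gram_schmidtP [seq col j M | j <- enum 'I_p].
split=> //; apply/andP; split; rewrite ?Qt.
  by apply: gram_schmidt_sub => _ /mapP[j _ ->]; rewrite tr_col row_sub.
have QM : gram_schmidt [seq col j M | j <- enum 'I_p] *m M = M.
  apply/matrixP => i j.
  have /colP/(_ i) := Qc (col j M) (map_f _ (mem_enum _ j)).
  rewrite [in X in _ = X]mxE => <-; rewrite [LHS]mxE [RHS]mxE.
  by apply: eq_bigr => k _; rewrite mxE.
by rewrite -[M in M^T]QM trmx_mul Qt submxMl.
Qed.

(** The form in which the equality of ranges is used: [Q] fixes the columns of
    [M], and the columns of [Q] are combinations of those of [M]. *)
Lemma is_range_projE n p (M : 'M[R]_(n, p)) Q : is_range_proj M Q ->
  Q *m M = M /\ exists Z, Q = M *m Z.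
Proof.
move=> [QQ Qt /andP[/submxP[D QD] /submxP[E ME]]]; split.
  by rewrite -[M]trmxK ME trmx_mul trmxK mulmxA QQ.
by exists D^T; rewrite -[Q]trmxK QD trmx_mul trmxK.
Qed.

(** Each of two such projectors absorbs the other on the left; transposing one of
    these identities makes them equal. *)
Lemma range_proj_uniq n p (M : 'M[R]_(n, p)) Q1 Q2 :
  is_range_proj M Q1 -> is_range_proj M Q2 -> Q1 = Q2.
Proof.
move=> h1 h2; have [[_ t1 _] [_ t2 _]] := (h1, h2).
have [M1 [Z1 e1]] := is_range_projE h1; have [M2 [Z2 e2]] := is_range_projE h2.
have <- : Q2 *m Q1 = Q1 by rewrite e1 mulmxA M2.
by rewrite -t2 -[in LHS]t1 -trmx_mul [in LHS]e2 mulmxA M1 -e2.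
Qed.

Lemma range_projP n p (M : 'M[R]_(n, p)) : is_range_proj M (range_proj M).
Proof.
apply: xgetPex; exists (gram_schmidt [seq col j M | j <- enum 'I_p]).
exact: gram_schmidt_range.
Qed.

Lemma range_projE n p (M : 'M[R]_(n, p)) :
  range_proj M = gram_schmidt [seq col j M | j <- enum 'I_p].
Proof. exact: range_proj_uniq (range_projP M) (gram_schmidt_range M). Qed.

Lemma range_proj0 n p : range_proj (0 : 'M[R]_(n, p)) = 0.
Proof.
have [_ [Z ->]] := is_range_projE (range_projP (0 : 'M[R]_(n, p))).
by rewrite mul0mx.
Qed.

(** Since [Q = Q^T Q], the diagonal entry [Q j j] is the squared norm of column
    [j]; it dominates its own square, hence is at most 1. *)
Lemma range_proj_entry_le1 n p (M : 'M[R]_(n, p)) i j : `|range_proj M i j| <= 1.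
Proof.
have [QQ Qt _] := range_projP M; set Q := range_proj M in QQ Qt *.
have Qjj : Q j j = \sum_k Q k j ^+ 2.
  rewrite -[in LHS]QQ mxE; apply: eq_bigr => k _.
  by rewrite -[in Q j k]Qt mxE expr2.
have le k : Q k j ^+ 2 <= Q j j.
  by rewrite Qjj (bigD1 k)//= lerDl sumr_ge0// => ? _; exact: sqr_ge0.
have Qjj1 : Q j j <= 1 by have := le j; nra.
rewrite -(@ler_pXn2r _ 2)// ?nnegrE// expr1n real_normK ?num_real//.
by rewrite (le_trans (le i)).
Qed.

(** Penrose's conditions hold for [Q2 V Q1], where [V] is any generalized inverse
    of [M] and [Q1], [Q2] are the projectors onto the ranges of [M] and [M^T]:
    its products with [M] are exactly [Q1] and [Q2]. *)
Lemma pinvP m n (M : 'M[R]_(m, n)) : is_pinv M (Defs.pinv M).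
Proof.
apply: xgetPex.
have [_ Q1t _] := range_projP M.
have [Q1M [Z1 e1]] := is_range_projE (range_projP M).
have [Q2Q2 Q2t _] := range_projP M^T.
have [Q2M [Z2 e2]] := is_range_projE (range_projP M^T).
set Q1 := range_proj M in Q1t Q1M e1 *.
set Q2 := range_proj M^T in Q2Q2 Q2t Q2M e2 *.
have MQ2 : M *m Q2 = M by rewrite -[M]trmxK -[in LHS]Q2t -trmx_mul Q2M.
have Q2e : Q2 = Z2^T *m M by rewrite -Q2t e2 trmx_mul trmxK.
have [V MVM] : exists V, M *m V *m M = M by exists (pinvmx M); rewrite mulmxKpV.
have MX : M *m (Q2 *m V *m Q1) = Q1.
  by rewrite !mulmxA MQ2 [in LHS]e1 mulmxA MVM -e1.
have XM : Q2 *m V *m Q1 *m M = Q2.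
  by rewrite -(mulmxA _ Q1) Q1M [in LHS]Q2e -!mulmxA (mulmxA M) MVM -Q2e.
exists (Q2 *m V *m Q1); split; rewrite ?MX ?XM//.
by rewrite !mulmxA Q2Q2.
Qed.

(** The matrix of a block Gauss-Seidel step, read in the coordinates given by
    the square root of [A], is an orthogonal projector.  The key point is
    [W X G = W] for [G = W^T W] and [X] its pseudo-inverse: the difference [D] of
    the two sides satisfies [D^T D = 0]. *)
Lemma range_proj_pinv n p (W : 'M[R]_(n, p)) :
  W *m Defs.pinv (W^T *m W) *m W^T = range_proj W.
Proof.
have [QQ Qt _] := range_projP W.
have [QW [Z eQ]] := is_range_projE (range_projP W).
set Q := range_proj W in QQ Qt QW eQ *.
(* [G] is made opaque so that [trmx_mul] does not rewrite inside it. *)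
have [G eG] : exists G, G = W^T *m W by eexists.
rewrite -eG; set X := Defs.pinv G.
have [GXG _ _ _] : is_pinv G X := pinvP G.
have Gt : G^T = G by rewrite eG trmx_mul trmxK.
have GXtG : G *m X^T *m G = G.
  by rewrite -[RHS]Gt -[in RHS]GXG !trmx_mul Gt mulmxA.
have WXG : W *m X *m G = W.
  apply/subr0_eq/mulmx_trmx_eq0.
  rewrite [(_ - _)^T]linearB/= !trmx_mul Gt mulmxBl !mulmxBr !mulmxA.
  by rewrite -!(mulmxA _ W^T W) -eG GXtG GXG !subrr.
have PQ : W *m X *m W^T *m Q = Q by rewrite eQ mulmxA -(mulmxA _ W^T) -eG WXG.
have QPt : Q *m (W *m X *m W^T)^T = (W *m X *m W^T)^T.
  by rewrite !trmx_mul trmxK !mulmxA QW.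
have Pt : (W *m X *m W^T)^T = Q.
  by rewrite -QPt -[in LHS]Qt -trmx_mul PQ Qt.
by rewrite -[LHS]trmxK Pt.
Qed.

End RangeProjection.

(** * Measurability of the range projector *)

(** The inverse is continuous off the closed point 0, where its value is 0. *)
Lemma measurable_invr (R : realType) : measurable_fun [set: R] (@GRing.inv R).
Proof.
rewrite -(setUv [set 0 : R]); apply/measurable_funU => //; first exact: measurableC.
split; first by apply: measurable_fun_set1.
apply: open_continuous_measurable_fun; first exact/closed_openC/closed_eq.
by move=> x /set_mem/eqP x0; exact: inv_continuous.
Qed.

Section MeasurableMatrices.
Context d (T : measurableType d) (R : realType).

Definition measurable_mx m n (F : T -> 'M[R]_(m, n)) : Prop :=
  forall i j, measurable_fun setT (fun w => F w i j).

Lemma measurable_mx_cst m n (M : 'M[R]_(m, n)) : measurable_mx (fun=> M).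
Proof. by move=> i j; exact: measurable_cst. Qed.

Lemma measurable_mxD m n (F G : T -> 'M[R]_(m, n)) :
  measurable_mx F -> measurable_mx G -> measurable_mx (fun w => F w + G w).
Proof.
move=> mF mG i j; under eq_fun do rewrite mxE.
by apply: measurable_funD; [exact: mF|exact: mG].
Qed.

Lemma measurable_mxZ m n (a : T -> R) (F : T -> 'M[R]_(m, n)) :
  measurable_fun setT a -> measurable_mx F ->
  measurable_mx (fun w => a w *: F w).
Proof.
move=> ma mF i j; under eq_fun do rewrite mxE.
by apply: measurable_funM => //; exact: mF.
Qed.

Lemma measurable_mxM m n p (F : T -> 'M[R]_(m, n)) (G : T -> 'M[R]_(n, p)) :
  measurable_mx F -> measurable_mx G -> measurable_mx (fun w => F w *m G w).
Proof.
move=> mF mG i j; under eq_fun do rewrite mxE.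
by apply: measurable_sum => k; apply: measurable_funM; [exact: mF|exact: mG].
Qed.

Lemma measurable_mx_tr m n (F : T -> 'M[R]_(m, n)) :
  measurable_mx F -> measurable_mx (fun w => (F w)^T).
Proof. by move=> mF i j; under eq_fun do rewrite mxE; exact: mF. Qed.

(** By uniqueness the projector is the one computed by the Gram-Schmidt
    recursion, which only uses measurable operations on entries. *)
Lemma measurable_range_proj n p (F : T -> 'M[R]_(n, p)) :
  measurable_mx F -> measurable_mx (fun w => range_proj (F w)).
Proof.
move=> mF; under eq_fun do rewrite range_projE.
elim: (enum 'I_p) => [|j js IH] /=; first exact: measurable_mx_cst.
have mr : measurable_mx (fun w => col j (F w) -
    gram_schmidt [seq col j (F w) | j <- js] *m col j (F w)).
  have mc : measurable_mx (fun w => col j (F w)).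
    by move=> i k; under eq_fun do rewrite mxE; exact: mF.
  apply: measurable_mxD => //; under eq_fun do rewrite -scaleN1r.
  by apply: measurable_mxZ => //; exact: measurable_mxM.
rewrite /gram_schmidt_step; apply: measurable_mxD => //; apply: measurable_mxZ.
  apply: (measurableT_comp (@measurable_invr R)).
  by apply: measurable_mxM => //; exact: measurable_mx_tr.
by apply: measurable_mxM => //; exact: measurable_mx_tr.
Qed.

End MeasurableMatrices.

Lemma measurable_borel_mx (R : realType) n p :
  measurable_mx (fun s : borel_mx R n p => s : 'M[R]_(n, p)).
Proof.
move=> i j; apply: (measurability _ (RGenOpens.measurableE R)) => _ [_ [a [b ->] <-]].
rewrite setTI; apply: sub_sigma_algebra.
have /continuousP cont : continuous (fun s : 'M[R]_(n, p) => s i j).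
  exact: coord_continuous.
exact/cont/interval_open.
Qed.

(** * Means of bounded measurable functions *)

Section BoundedMeasurable.
Context d (T : measurableType d) (R : realType).

Definition bounded_meas (f : T -> R) : Prop :=
  measurable_fun setT f /\ exists K, forall w, `|f w| <= K.

Lemma bounded_meas_cst c : bounded_meas (fun=> c).
Proof. by split; [exact: measurable_cst|exists `|c|]. Qed.

Lemma bounded_measD f g :
  bounded_meas f -> bounded_meas g -> bounded_meas (fun w => f w + g w).
Proof.
move=> [mf [K fK]] [mg [L gL]]; split; first exact: measurable_funD.
by exists (K + L) => w; rewrite (le_trans (ler_normD _ _))// lerD.
Qed.

Lemma bounded_measM f g :
  bounded_meas f -> bounded_meas g -> bounded_meas (fun w => f w * g w).
Proof.
move=> [mf [K fK]] [mg [L gL]]; split; first exact: measurable_funM.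
by exists (K * L) => w; rewrite normrM ler_pM.
Qed.

Lemma bounded_meas_sum (I : Type) (s : seq I) (F : I -> T -> R) :
  (forall i, bounded_meas (F i)) -> bounded_meas (fun w => \sum_(i <- s) F i w).
Proof.
move=> bF; elim: s => [|i s IH].
  by under eq_fun do rewrite big_nil; exact: bounded_meas_cst.
by under eq_fun do rewrite big_cons; exact: bounded_measD.
Qed.

Lemma bounded_meas_indic D : measurable D -> bounded_meas \1_D.
Proof.
move=> mD; split; first exact: measurable_indic.
by exists 1 => w; rewrite indicE; case: (_ \in _); rewrite ?normr1 ?normr0.
Qed.

(** Passage from events to bounded functions.  For [f] with values in [0, 1] the
    function [2 f - 1_(f >= 1/2)] again has values in [0, 1], and [Delta]
    vanishes on the indicator, so [|Delta f|] is half of a value subject to the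
    same uniform bound [M].  Iterating, [|Delta f| <= M / 2^n] for every [n]. An
    arbitrary bounded function is an affine image of such an [f]. *)
Lemma bounded_linear_vanish (Delta : (T -> R) -> R) (M : R) :
  (forall f g, bounded_meas f -> bounded_meas g ->
     Delta (fun x => f x + g x) = Delta f + Delta g) ->
  (forall a f, bounded_meas f -> Delta (fun x => a * f x) = a * Delta f) ->
  (forall D, measurable D -> Delta \1_D = 0) ->
  (forall f, bounded_meas f -> (forall x, 0 <= f x <= 1) -> `|Delta f| <= M) ->
  forall f, bounded_meas f -> Delta f = 0.
Proof.
move=> DD DZ D1 DM.
have halve n : forall f, bounded_meas f -> (forall x, 0 <= f x <= 1) ->
    `|Delta f| * 2 ^+ n <= M.
  elim: n => [|n IH] f bf f01; first by rewrite expr0 mulr1 DM.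
  pose D : set T := [set x | 1/2 <= f x].
  have mD : measurable D.
    have := bf.1 measurableT `[1/2, +oo[%classic (measurable_itv _).
    by rewrite setTI preimage_itvcy.
  have b1 : bounded_meas (fun x => - 1 * \1_D x).
    by apply: bounded_measM; [exact: bounded_meas_cst|exact: bounded_meas_indic].
  have b2 : bounded_meas (fun x => 2 * f x).
    by apply: bounded_measM => //; exact: bounded_meas_cst.
  have g01 x : 0 <= 2 * f x + - 1 * \1_D x <= 1.
    have /andP[f0 f1] := f01 x; rewrite indicE.
    have [|/negP] := boolP (x \in D); rewrite inE /D/= => xD; first lra.
    by move/negP: xD; rewrite -ltNge; lra.
  have := IH _ (bounded_measD b2 b1) g01.
  rewrite DD// !DZ//; last exact: bounded_meas_indic.
  by rewrite D1// mulr0 addr0 normrM ger0_norm// exprSr; nra.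
have vanish01 f : bounded_meas f -> (forall x, 0 <= f x <= 1) -> Delta f = 0.
  move=> bf f01; apply/eqP; apply: contraT => Df0.
  have Dpos : 0 < `|Delta f| by rewrite normr_gt0.
  have M0 : 0 <= M by rewrite (le_trans _ (DM f bf f01)).
  have := archi_boundP (divr_ge0 M0 (ltW Dpos)).
  rewrite ltr_pdivrMr// ltNge; set n := Num.bound _.
  rewrite (le_trans _ (halve n f bf f01))// mulrC ler_wpM2l//.
  by rewrite -natrX ler_nat ltnW// ltn_expl.
(* [`|K| + 1] rather than [K], so that the rescaling factor is nonzero. *)
move=> f bf; have [mf [K fK]] := bf.
pose L := `|K| + 1; have L0 : 0 < L by rewrite ltr_pwDr.
have fL x : - L <= f x <= L.
  by rewrite -ler_norml (le_trans (fK x))// (le_trans (ler_norm K))// lerDl.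
pose g x := (2 * L)^-1 * (f x + L).
have bg : bounded_meas g.
  apply: bounded_measM; first exact: bounded_meas_cst.
  by apply: bounded_measD => //; exact: bounded_meas_cst.
have g01 x : 0 <= g x <= 1.
  have /andP[h1 h2] := fL x; rewrite /g mulrC ler_pdivlMr ?ler_pdivrMr; lra.
have fE : f = (fun x => 2 * L * g x + - L * \1_setT x).
  by apply/funext => x; rewrite indicT /g/=; field; rewrite gt_eqF.
have b1 : bounded_meas (\1_setT : T -> R) by exact: bounded_meas_indic.
rewrite fE (DD _ _ (bounded_measM (bounded_meas_cst _) bg)
                  (bounded_measM (bounded_meas_cst _) b1)).
by rewrite (DZ _ _ bg) (DZ _ _ b1) (vanish01 _ bg)// D1// !mulr0 addr0.
Qed.

End BoundedMeasurable.

Lemma bounded_meas_comp d d' (T : measurableType d) (T' : measurableType d')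
    (R : realType) (X : T -> T') (f : T' -> R) :
  measurable_fun setT X -> bounded_meas f -> bounded_meas (fun w => f (X w)).
Proof.
by move=> mX [mf [K fK]]; split; [exact: measurableT_comp|exists K => w].
Qed.

Section Mean.
Context d (T : measurableType d) (R : realType) (P : probability T R).

(** The real-valued expectation; for bounded measurable functions it agrees with
    the extended-real one and is linear without side conditions at infinity. *)
Definition mean (f : T -> R) : R := \int[P]_w f w.

Lemma bounded_meas_integrable f :
  bounded_meas f -> P.-integrable setT (EFin \o f).
Proof.
move=> [mf [K fK]]; apply: measurable_bounded_integrable => //.
  by rewrite [ltLHS]probability_setT ltry.
exists K; split; first exact: num_real.
by move=> x Kx w _ /=; rewrite (le_trans (fK w))// ltW.
Qed.

Lemma meanD f g : bounded_meas f -> bounded_meas g ->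
  mean (fun w => f w + g w) = mean f + mean g.
Proof. by move=> bf bg; apply: RintegralD => //; exact: bounded_meas_integrable. Qed.

Lemma meanZ a f : bounded_meas f -> mean (fun w => a * f w) = a * mean f.
Proof. by move=> bf; apply: RintegralZl => //; exact: bounded_meas_integrable. Qed.

Lemma mean_cst c : mean (fun=> c) = c.
Proof.
by have := expectation_cst P c; rewrite unlock /mean /Rintegral/= => ->.
Qed.

Lemma mean_sum (I : Type) (s : seq I) (F : I -> T -> R) :
  (forall i, bounded_meas (F i)) ->
  mean (fun w => \sum_(i <- s) F i w) = \sum_(i <- s) mean (F i).
Proof.
move=> bF; elim: s => [|i s IH].
  by under eq_fun do rewrite big_nil; rewrite mean_cst big_nil.
under eq_fun do rewrite big_cons.
by rewrite meanD ?IH ?big_cons//; exact: bounded_meas_sum.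
Qed.

Lemma mean_indic D : measurable D -> mean \1_D = fine (P D).
Proof. by move=> mD; rewrite /mean /Rintegral integral_indic// setIT. Qed.

Lemma le_mean f g : bounded_meas f -> bounded_meas g ->
  (forall w, f w <= g w) -> mean f <= mean g.
Proof.
by move=> bf bg fg; apply: le_Rintegral => //; exact: bounded_meas_integrable.
Qed.

Lemma mean_norm_le f K :
  bounded_meas f -> (forall w, `|f w| <= K) -> `|mean f| <= K.
Proof.
move=> bf fK; rewrite ler_norml; apply/andP; split.
  rewrite -[leLHS]mean_cst; apply: le_mean => // [|w]; first exact: bounded_meas_cst.
  by have := fK w; rewrite ler_norml => /andP[].
rewrite -[leRHS]mean_cst; apply: le_mean => // [|w]; first exact: bounded_meas_cst.
by rewrite (le_trans (ler_norm _)).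
Qed.

Lemma expectation_mean f : bounded_meas f -> ('E_P[f] = (mean f)%:E)%E.
Proof.
move=> bf; rewrite unlock /mean /Rintegral fineK//.
by apply: integrable_fin_num => //; exact: bounded_meas_integrable.
Qed.

(** To identify the mean of [h f(X)] for all bounded [f], indicators suffice: the
    difference of the two sides is a linear functional of [f] bounded by
    [K + |c|] on functions with values in [0, 1].  The weight [h] may be signed. *)
Lemma mean_mul_comp_ext d' (T' : measurableType d') (X Y : T -> T') h c :
  measurable_fun setT X -> measurable_fun setT Y -> bounded_meas h ->
  (forall D, measurable D ->
     mean (fun w => h w * \1_D (X w)) = c * fine (P (Y @^-1` D))) ->
  forall f, bounded_meas f ->
    mean (fun w => h w * f (X w)) = c * mean (fun w => f (Y w)).
Proof.
move=> mX mY bh hX f bf.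
have [_ [K hK]] := bh.
pose Delta f := mean (fun w => h w * f (X w)) + - c * mean (fun w => f (Y w)).
have bX f' : bounded_meas f' -> bounded_meas (fun w => h w * f' (X w)).
  by move=> bf'; exact: bounded_measM bh (bounded_meas_comp mX bf').
have bY (f' : T' -> R) : bounded_meas f' -> bounded_meas (fun w => f' (Y w)).
  exact: bounded_meas_comp.
suff : Delta f = 0 by rewrite /Delta mulNr => /subr0_eq.
apply: (@bounded_linear_vanish _ _ _ Delta (K + `|c|)) bf => /=.
- move=> f1 f2 b1 b2; rewrite /Delta; under eq_fun do rewrite mulrDr.
  by rewrite (meanD (bX _ b1) (bX _ b2)) (meanD (bY _ b1) (bY _ b2)); ring.
- move=> a f1 b1; rewrite /Delta; under eq_fun do rewrite mulrCA.
  by rewrite (meanZ _ (bX _ b1)) (meanZ _ (bY _ b1)); ring.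
- move=> D mD.
  have mYD : measurable (Y @^-1` D).
    by have := mY measurableT D mD; rewrite setTI.
  rewrite /Delta hX// -(mean_indic mYD) mulNr; exact: subrr.
- move=> f1 b1 f01; rewrite /Delta (le_trans (ler_normD _ _))// lerD//.
    apply: mean_norm_le; first exact: bX.
    move=> w; rewrite normrM -[K]mulr1 ler_pM//.
    by have /andP[? ?] := f01 (X w); rewrite ger0_norm.
  rewrite normrM normrN -[leRHS]mulr1 ler_wpM2l//.
  apply: mean_norm_le; first exact: bY.
  by move=> w; have /andP[? ?] := f01 (Y w); rewrite ger0_norm.
Qed.

End Mean.

Lemma bounded_meas_sqrt d (T : measurableType d) (R : realType) (f : T -> R) :
  bounded_meas f -> bounded_meas (fun w => Num.sqrt (f w)).
Proof.
move=> [mf [K fK]]; split.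
  have msqrt : measurable_fun setT (@Num.sqrt R).
    by apply: continuous_measurable_fun; exact: sqrt_continuous.
  exact: (measurableT_comp msqrt mf).
exists (Num.sqrt K) => w; rewrite ger0_norm ?sqrtr_ge0// ler_wsqrtr//.
by rewrite (le_trans (ler_norm _)).
Qed.

(** * Products of independent random matrices *)

Fixpoint mx_product (R : realType) (T' : Type) n (F : T' -> 'M[R]_n)
    (s : nat -> T') (v : 'cV[R]_n) (k : nat) : 'cV[R]_n :=
  if k is k'.+1 then F (s k') *m mx_product F s v k' else v.

Section Independence.
Context d (T : measurableType d) (R : realType) (P : probability T R).
Context d' (T' : measurableType d').
Variables (X : nat -> {RV P >-> T'}) (Y : {RV P >-> T'}).
Hypothesis X_indep : mutually_independent X.
Hypothesis X_copy : forall k, same_distribution (X k) Y.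

(** The cylinder events on the variables of index at least [m].  They are stable
    under the intersections needed here, so no generated sigma-algebra has to be
    introduced. *)
Definition future m (C : set T) : Prop :=
  exists (J : {fset nat}) (B : nat -> set T'),
    [/\ forall i, measurable (B i), forall i, i \in J -> (m <= i)%N &
        C = \bigcap_(i in [set` J]) (X i @^-1` B i)].

Lemma measurable_preim k D : measurable D -> measurable (X k @^-1` D).
Proof. by move=> mD; rewrite -[_ @^-1` _]setTI; exact: measurable_funPT. Qed.

Lemma future_setT m : future m setT.
Proof.
exists fset0, (fun=> setT); split=> //.
by apply/seteqP; split=> // w _ i; rewrite /= inE.
Qed.

Lemma future_measurable m C : future m C -> measurable C.
Proof.
move=> [J [B [mB _ ->]]]; rewrite bigcap_fset.
by apply: bigsetI_measurable => i _; exact: measurable_preim.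
Qed.

(** The factor that mutual independence lets one split off: an event on [X m]
    is independent of the events on later variables. *)
Lemma future_extend m C D : measurable D -> future m.+1 C ->
  future m (C `&` X m @^-1` D) /\
  fine (P (C `&` X m @^-1` D)) = fine (P C) * fine (P (X m @^-1` D)).
Proof.
move=> mD [J [B [mB mJ ->]]].
pose B' i := if i == m then D else B i.
have mB' i : measurable (B' i) by rewrite /B'; case: ifP.
have mnJ : m \notin J by apply/negP => /mJ; rewrite ltnn.
have JE : (\bigcap_(i in [set` J]) (X i @^-1` B i)) `&` X m @^-1` D =
    \bigcap_(i in [set` (m |` J)%fset]) (X i @^-1` B' i).
  apply/seteqP; split=> w.
    move=> [wJ wD] i; rewrite /= in_fset1U /B'; case: eqP => [->//|_ /= iJ].
    exact: wJ.
  move=> wJ; split; last first.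
    by have := wJ m; rewrite /= in_fset1U eqxx /B' eqxx; exact.
  move=> i iJ; have := wJ i; rewrite /= in_fset1U /B'.
  have -> : (i == m) = false by apply/eqP => im; rewrite -im iJ in mnJ.
  by apply.
split.
  exists (m |` J)%fset, B'; split=> // i.
  by rewrite in_fset1U => /predU1P[->//|/mJ]; exact: ltnW.
rewrite JE X_indep// big_fsetU1//= {1}/B' eqxx X_indep//.
rewrite fineM ?fin_num_measure//; last 2 first.
- exact: measurable_preim.
- rewrite -X_indep//; apply: fin_num_measure.
  rewrite bigcap_fset.
  by apply: bigsetI_measurable => i _; exact: measurable_preim.
rewrite mulrC; congr (fine _ * _); rewrite !big_seq.
apply: eq_bigr => i iJ; rewrite /B'.
by case: eqP => // im; rewrite -im iJ in mnJ.
Qed.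

(** The invariant that replaces measurability with respect to the past: [h] is
    uncorrelated with every event of the future.  It is stable under sums and,
    by [indep_future_step], under multiplication by a function of [X m] at the
    cost of moving the future one step ahead. *)
Definition indep_future m (h : T -> R) : Prop :=
  bounded_meas h /\
  forall C, future m C -> mean P (fun w => h w * \1_C w) = mean P h * fine (P C).

Lemma indep_future_cst m c : indep_future m (fun=> c).
Proof.
split; first exact: bounded_meas_cst.
move=> C /future_measurable mC.
by rewrite meanZ ?mean_cst ?mean_indic//; exact: bounded_meas_indic.
Qed.

Lemma indep_future_sum m (I : Type) (s : seq I) (F : I -> T -> R) :
  (forall i, indep_future m (F i)) ->
  indep_future m (fun w => \sum_(i <- s) F i w).
Proof.
move=> iF; have bF i : bounded_meas (F i) := (iF i).1.
split; first exact: bounded_meas_sum.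
move=> C fC; have bC := @bounded_meas_indic _ _ R _ (future_measurable fC).
under eq_fun do rewrite mulr_suml.
rewrite !mean_sum ?mulr_suml//; last by move=> i; exact: bounded_measM.
by apply: eq_bigr => i _; rewrite (iF i).2.
Qed.

(** Fix a later event [C] and view [h 1_C] as a weight.  For indicators of [X m]
    the mean factors because [C] intersected with an event on [X m] is a future
    event for [h]; [mean_mul_comp_ext] extends this to bounded [f] and replaces
    [X m] by its copy [Y] at the same time.  Taking [C] to be the whole space
    gives the product formula for the means. *)
Lemma indep_future_step m h (f : T' -> R) :
  indep_future m h -> bounded_meas f ->
  indep_future m.+1 (fun w => h w * f (X m w)) /\
  mean P (fun w => h w * f (X m w)) = mean P h * mean P (fun w => f (Y w)).
Proof.
move=> [bh ih] bf.
have split_off C : future m.+1 C ->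
    mean P (fun w => h w * f (X m w) * \1_C w) =
    mean P h * fine (P C) * mean P (fun w => f (Y w)).
  move=> fC; have bC := @bounded_meas_indic _ _ R _ (future_measurable fC).
  under eq_fun do rewrite mulrAC.
  apply: (mean_mul_comp_ext (h := fun w => h w * \1_C w)) => //.
    exact: bounded_measM.
  move=> D mD; have [fCD PCD] := future_extend mD fC.
  transitivity (mean P (fun w => h w * \1_(C `&` X m @^-1` D) w)).
    by congr (mean P _); apply/funext => w; rewrite indicI -mulrA.
  rewrite ih// PCD mulrA; congr (_ * fine _).
  exact: X_copy.
have meanE : mean P (fun w => h w * f (X m w)) =
    mean P h * mean P (fun w => f (Y w)).
  have := split_off _ (future_setT _).
  have := mean_indic P (@measurableT _ T); rewrite indicT mean_cst => <-.
  by rewrite mulr1; under eq_fun do rewrite mulr1.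
split=> //; split; last by move=> C fC; rewrite split_off// meanE mulrAC.
by apply: bounded_measM => //; exact: bounded_meas_comp.
Qed.

Variables (n : nat) (F : T' -> 'M[R]_n).
Hypothesis F_bounded : forall i j, bounded_meas (fun s => F s i j).

Lemma indep_future_product (v : 'cV[R]_n) k i :
  indep_future k (fun w => mx_product F (X ^~ w) v k i 0).
Proof.
elim: k i => [|k IH] i /=; first exact: indep_future_cst.
under eq_fun do rewrite mxE.
apply: indep_future_sum => j; under eq_fun do rewrite mulrC.
exact: (indep_future_step (IH j) (F_bounded i j)).1.
Qed.

(** The mean of the product vector obeys the deterministic recursion
    [E (k+1) = M E k], [M] being the mean of one factor, and [u] is a left
    eigenvector of [M]. *)
Lemma mean_product (u : 'rV[R]_n) (v : 'cV[R]_n) a k :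
  u *m (\matrix_(i, j) mean P (fun w => F (Y w) i j)) = a *: u ->
  mean P (fun w => (u *m mx_product F (X ^~ w) v k) 0 0) =
  a ^+ k * (u *m v) 0 0.
Proof.
move=> uF.
pose E k : 'cV[R]_n := \col_i mean P (fun w => mx_product F (X ^~ w) v k i 0).
have bprod k' i : bounded_meas (fun w => mx_product F (X ^~ w) v k' i 0).
  exact: (indep_future_product v k' i).1.
have ES k' : E k'.+1 = \matrix_(i, j) mean P (fun w => F (Y w) i j) *m E k'.
  apply/colP => i; rewrite !mxE /=; under eq_fun do rewrite mxE.
  rewrite mean_sum => [|j]; last first.
    apply: bounded_measM (bprod k' j).
    exact: bounded_meas_comp (measurable_funPT (X k')) (F_bounded i j).
  apply: eq_bigr => j _; rewrite !mxE mulrC.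
  under eq_fun do rewrite mulrC.
  exact: (indep_future_step (indep_future_product v k' j) (F_bounded i j)).2.
have uE : (u *m E k) 0 0 = a ^+ k * (u *m v) 0 0.
  elim: k => [|k' IH].
    rewrite expr0 mul1r; congr ((_ *m _) 0 0).
    by apply/colP => i; rewrite mxE mean_cst.
  by rewrite ES mulmxA uF -scalemxAl mxE IH exprS mulrA.
rewrite -uE mxE; under eq_fun do rewrite mxE.
rewrite mean_sum => [|i]; last first.
  by apply: bounded_measM => //; exact: bounded_meas_cst.
by apply: eq_bigr => i _; rewrite mxE meanZ.
Qed.

End Independence.

(** * The error of the Gauss-Seidel iteration *)

Section GaussSeidelError.
Context (R : realType) (n : nat) (A B : 'M[R]_n).
Hypotheses (Bt : B^T = B) (BB : B *m B = A).

Lemma mxnorm_sqrt (x : 'cV[R]_n) :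
  mxnorm A x = Num.sqrt (((B *m x)^T *m (B *m x)) 0 0).
Proof. by rewrite /mxnorm /quad_form -BB trmx_mul Bt !mulmxA. Qed.

Lemma sqrt_unitmx : posdef A -> B \in unitmx.
Proof.
move=> [_ Apos]; rewrite -row_free_unit; apply: inj_row_free => v vB.
apply/eqP; apply: contraT => v0.
have := Apos v^T; rewrite trmx_eq0 => /(_ v0).
by rewrite /quad_form trmxK -BB mulmxA vB !mul0mx mxE ltxx.
Qed.

(** In the coordinates [B x] with [B^2 = A], one step of the method subtracts
    from the error its orthogonal projection onto the range of [B s k]. *)
Lemma gauss_seidel_error p b xstar (s : nat -> 'M[R]_(n, p)) x0 k :
  A *m xstar = b ->
  B *m (gauss_seidel A b s x0 k - xstar) =
  mx_product (fun S => 1%:M - range_proj (B *m S)) s (B *m (x0 - xstar)) k.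
Proof.
move=> Ax; elim: k => [//|k IH] /=.
set x := gauss_seidel A b s x0 k in IH *; rewrite -IH.
have WW : (B *m s k)^T *m (B *m s k) = (s k)^T *m A *m s k.
  by rewrite trmx_mul Bt -BB !mulmxA.
rewrite -range_proj_pinv WW trmx_mul Bt -Ax -mulmxBr addrAC.
by rewrite [LHS]mulmxBr mulmxBl mul1mx -BB !mulmxA.
Qed.

End GaussSeidelError.

(** From [0 <= |a e - b u^T|^2 = a (a c - b^2)], where [a], [c] are the squared
    norms of [u], [e] and [b] is their product. *)
Lemma row_col_CauchySchwarz (R : realType) n (u : 'rV[R]_n) (e : 'cV[R]_n) :
  (u *m e) 0 0 <= Num.sqrt ((u *m u^T) 0 0) * Num.sqrt ((e^T *m e) 0 0).
Proof.
set a := (u *m u^T) 0 0; set c := (e^T *m e) 0 0; set b := (u *m e) 0 0.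
have aE : a = \sum_i u 0 i ^+ 2.
  by rewrite /a mxE; apply: eq_bigr => i _; rewrite mxE expr2.
have cE : c = \sum_i e i 0 ^+ 2 by rewrite /c col_sqnorm.
have bE : b = \sum_i u 0 i * e i 0 by rewrite /b mxE.
have a0 : 0 <= a by rewrite aE sumr_ge0// => i _; exact: sqr_ge0.
have c0 : 0 <= c by rewrite cE sumr_ge0// => i _; exact: sqr_ge0.
have key : 0 <= a * (a * c - b ^+ 2).
  have <- : \sum_i (a * e i 0 - b * u 0 i) ^+ 2 = a * (a * c - b ^+ 2).
    transitivity (\sum_i (a ^+ 2 * e i 0 ^+ 2 +
        (- 2 * a * b * (u 0 i * e i 0) + b ^+ 2 * u 0 i ^+ 2))).
      by apply: eq_bigr => i _; ring.
    by rewrite !big_split/= -!mulr_sumr -aE -bE -cE; ring.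
  by rewrite sumr_ge0// => i _; exact: sqr_ge0.
have bac : b ^+ 2 <= a * c.
  have [a_eq0|a_neq0] := eqVneq a 0; last first.
    by rewrite -subr_ge0 -(pmulr_rge0 _ (_ : 0 < a))// lt_def a_neq0.
  suff -> : b = 0 by rewrite expr0n/= mulr_ge0.
  rewrite bE big1// => i _.
  have /eqP : u 0 i ^+ 2 = 0.
    have := a_eq0; rewrite aE => /psumr_eq0P -> // j _; exact: sqr_ge0.
  by rewrite sqrf_eq0 => /eqP ->; rewrite mul0r.
rewrite -sqrtrM// (le_trans (ler_norm _))// -sqrtr_sqr ler_wsqrtr//.
Qed.

(** The two outcomes of the choice defining the square root.  The first one is
    excluded in the theorem by the positivity of [mu]. *)
Lemma psd_sqrt_cases (R : realType) n (A : 'M[R]_n) :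
  psd_sqrt A = 0 \/ (psd_sqrt A)^T = psd_sqrt A /\ psd_sqrt A *m psd_sqrt A = A.
Proof.
rewrite /psd_sqrt; case: xgetP => [X -> [[Xt _] XX]|_]; first by right.
by left.
Qed.

Theorem proposition3p3 (R : realType) (n p : nat)
    (A : 'M[R]_n) (b : 'cV[R]_n) (hA : posdef A)
    (d : measure_display) (T : measurableType d) (P : probability T R)
    (S : {RV P >-> borel_mx R n p}) (mu : R)
    (hmu : is_lambda_min
             (expectation_mx P (fun w => range_proj (psd_sqrt A *m S w))) mu)
    (mu_gt0 : 0 < mu)
    (xstar : 'cV[R]_n) (hxstar : A *m xstar = b)
    (Sk : nat -> {RV P >-> borel_mx R n p})
    (Sk_indep : mutually_independent Sk)
    (Sk_copy : forall k : nat, same_distribution (Sk k) S) :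
  exists x0 : 'cV[R]_n, x0 <> xstar /\
    forall k : nat,
      (((1 - mu) ^+ k * mxnorm A (x0 - xstar))%:E <=
       'E_P[fun w => mxnorm A
              (gauss_seidel A b (fun i => Sk i w) x0 k - xstar)])%E.
Proof.
have [/eigenvalueP[u uE u0] _] := hmu.
have [B0|[Bt BB]] := psd_sqrt_cases A.
  (* A zero root would make every projector zero, hence [mu = 0]. *)
  have E0 : expectation_mx P (fun w => range_proj (psd_sqrt A *m S w)) = 0.
    apply/matrixP => i j; rewrite !mxE B0.
    under eq_fun do rewrite mul0mx range_proj0 mxE.
    by rewrite expectation_cst.
  move: uE; rewrite E0 mulmx0 => /esym/eqP.
  by rewrite scaler_eq0 (negPf u0) orbF gt_eqF.
set B := psd_sqrt A in uE Bt BB.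
have Bunit := sqrt_unitmx BB hA.
(* Chosen so that the transformed initial error is the eigenvector itself. *)
pose x0 := xstar + invmx B *m u^T.
have e0 : B *m (x0 - xstar) = u^T by rewrite /x0 addrC addKr mulKVmx.
exists x0; split.
  move=> x0E; move: e0; rewrite x0E subrr mulmx0 => /esym/eqP.
  by rewrite trmx_eq0 (negPf u0).
move=> k.
pose F (s : borel_mx R n p) : 'M[R]_n := 1%:M - range_proj (B *m s).
have bQ i j : bounded_meas (fun s : borel_mx R n p => range_proj (B *m s) i j).
  split; last by exists 1 => s; exact: range_proj_entry_le1.
  apply: measurable_range_proj; apply: measurable_mxM.
    exact: measurable_mx_cst.
  exact: measurable_borel_mx.
have bF i j : bounded_meas (fun s => F s i j).
  rewrite /F; under eq_fun do rewrite mxE [X in _ + X]mxE -mulN1r.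
  apply: bounded_measD; first exact: bounded_meas_cst.
  by apply: bounded_measM => //; exact: bounded_meas_cst.
have uF : u *m (\matrix_(i, j) mean P (fun w => F (S w) i j)) = (1 - mu) *: u.
  rewrite scalerBl scale1r -uE -[X in _ = X - _]mulmx1 -mulmxBr; congr (_ *m _).
  apply/matrixP => i j; rewrite !mxE /F.
  have bQS := bounded_meas_comp (measurable_funPT S) (bQ i j).
  rewrite expectation_mean//= -mulN1r -meanZ// -[X in X + _](mean_cst P) -meanD//.
  - by congr (mean P _); apply/funext => w; rewrite !mxE mulN1r.
  - exact: bounded_meas_cst.
  - by apply: bounded_measM => //; exact: bounded_meas_cst.
pose e w := mx_product F (fun i => Sk i w) u^T k.
have be i : bounded_meas (fun w => e w i 0).
  exact: (indep_future_product Sk_indep Sk_copy bF u^T k i).1.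
have errE w : B *m (gauss_seidel A b (fun i => Sk i w) x0 k - xstar) = e w.
  by rewrite (gauss_seidel_error Bt BB)// e0.
have bnorm : bounded_meas (fun w => Num.sqrt (((e w)^T *m e w) 0 0)).
  apply: bounded_meas_sqrt; under eq_fun do rewrite col_sqnorm.
  apply: bounded_meas_sum => i; under eq_fun do rewrite expr2.
  exact: bounded_measM.
under [X in 'E_P[X]%E]eq_fun do rewrite (mxnorm_sqrt Bt BB) errE.
rewrite expectation_mean// lee_fin (mxnorm_sqrt Bt BB) e0 trmxK.
set nu := Num.sqrt _.
have uu0 : 0 < (u *m u^T) 0 0.
  have := col_sqnorm_eq0 u^T; rewrite trmxK trmx_eq0 (negPf u0) => /negbT uu.
  rewrite lt_def uu (_ : (u *m u^T) 0 0 = \sum_i u^T i 0 ^+ 2).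
    by rewrite sumr_ge0// => i _; exact: sqr_ge0.
  by rewrite -col_sqnorm trmxK.
have nu0 : 0 < nu by rewrite sqrtr_gt0.
have nu2 : nu * nu = (u *m u^T) 0 0 by rewrite -expr2 sqr_sqrtr// ltW.
(* Multiplying by [nu = |u|] turns the left side into [(1 - mu)^k |u|^2], which is
   the mean of [u e]. *)
rewrite -(ler_pM2l nu0) mulrCA nu2.
rewrite -(mean_product Sk_indep Sk_copy bF _ _ uF) -meanZ//.
apply: le_mean => [||w]; last exact: row_col_CauchySchwarz.
- under eq_fun do rewrite mxE; apply: bounded_meas_sum => i.
  by apply: bounded_measM => //; exact: bounded_meas_cst.
- by apply: bounded_measM => //; exact: bounded_meas_cst.
Qed.
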